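(* Let $(\mathcal{E},\mathcal{S})$ be a category with display maps (in the sense of van den Berg–Moerdijk's framework for algebraic set theory, so that its bounded exact completion $(\overline{\mathcal{E}},\overline{\mathcal{S}})$ is defined). If the axiom of multiple choice $\mathbf{(AMC)}$ holds in $(\mathcal{E},\mathcal{S})$ (with ''small map'' read as ''display map''), then $\mathbf{(AMC)}$ holds in $(\overline{\mathcal{E}},\overline{\mathcal{S}})$.
   Context: Covers are regular epimorphisms. A commuting square with top $q: D\to B$, left $g: D\to C$, right $f: B\to A$, bottom $p: C\to A$ is a covering square if $p$ and the canonical map $D\to B\times_A C$ are covers; it is a collection square if moreover, in the internal logic, for all $a\in A$ and every cover $e: E\twoheadrightarrow B_a$ there are $c\in p^{-1}(a)$ and $h: D_c\to E$ with $e h = q\restriction D_c$. $\mathbf{(AMC)}$ (categorical form): for every small map $f: Y\to X$ there is a cover $q: A\to X$ such that the pullback $q^*f: A\times_X Y\to A$ is the right edge of a collection square in which all maps are small. The bounded exact completion $\overline{\mathcal{E}}$ comes with a full embedding $\mathbf{y}: \mathcal{E}\to\overline{\mathcal{E}}$; a map in $\overline{\mathcal{E}}$ is in $\overline{\mathcal{S}}$ (small) iff it is covered by a map of the form $\mathbf{y}f'$ with $f'$ a display map in $\mathcal{E}$. *)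

(* Defs.v *)
(* Equality of morphisms is Leibniz equality, so functional and propositional
   extensionality are used to identify subobjects with the same generalized
   elements. *)
From Corelib Require Import ssreflect.
From Stdlib Require Import FunctionalExtensionality PropExtensionality
  ProofIrrelevance.

Set Implicit Arguments.
Unset Strict Implicit.
Unset Printing Implicit Defensive.

Record category := Category {
  ob :> Type;
  hom : ob -> ob -> Type;
  idm : forall X, hom X X;
  comp : forall X Y Z, hom Y Z -> hom X Y -> hom X Z;
  comp_idl : forall X Y (f : hom X Y), comp (idm Y) f = f;
  comp_idr : forall X Y (f : hom X Y), comp f (idm X) = f;
  compA : forall X Y Z W (h : hom Z W) (g : hom Y Z) (f : hom X Y),
    comp h (comp g f) = comp (comp h g) f
}.

Arguments hom {c} X Y.
Arguments idm {c} X.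
Arguments comp {c X Y Z} g f.

Declare Scope cat_scope.
Delimit Scope cat_scope with cat.
Local Open Scope cat_scope.
Notation "g ∘ f" := (comp g f) (at level 40, left associativity) : cat_scope.

Definition map_class (C : category) := forall X Y : C, hom X Y -> Prop.

Section Notions.
Context {C : category}.
Implicit Types X Y Z W P : C.

Definition mono X Y (m : hom X Y) : Prop :=
  forall W (u v : hom W X), m ∘ u = m ∘ v -> u = v.

Definition is_coequalizer W X Y (u v : hom W X) (e : hom X Y) : Prop :=
  e ∘ u = e ∘ v /\
  forall Z (k : hom X Z), k ∘ u = k ∘ v -> exists! h : hom Y Z, h ∘ e = k.

(* Covers are regular epimorphisms. *)
Definition cover X Y (e : hom X Y) : Prop :=
  exists W (u v : hom W X), is_coequalizer u v e.

Definition is_terminal T : Prop := forall X, exists f : hom X T, forall g, g = f.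

Definition is_initial O : Prop := forall X, exists f : hom O X, forall g, g = f.

Definition is_product X Y P (p1 : hom P X) (p2 : hom P Y) : Prop :=
  forall W (a : hom W X) (b : hom W Y),
    exists! h : hom W P, p1 ∘ h = a /\ p2 ∘ h = b.

Definition is_coproduct X Y P (i1 : hom X P) (i2 : hom Y P) : Prop :=
  forall W (a : hom X W) (b : hom Y W),
    exists! h : hom P W, h ∘ i1 = a /\ h ∘ i2 = b.

Definition is_pullback P X Y Z
    (p1 : hom P X) (p2 : hom P Y) (f : hom X Z) (g : hom Y Z) : Prop :=
  f ∘ p1 = g ∘ p2 /\
  forall W (a : hom W X) (b : hom W Y), f ∘ a = g ∘ b ->
    exists! h : hom W P, p1 ∘ h = a /\ p2 ∘ h = b.

(* For monomorphisms m, n into X this is the order on subobjects of X. *)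
Definition factors A B X (m : hom A X) (n : hom B X) : Prop :=
  exists h : hom A B, n ∘ h = m.

(* The subobject n of X is the value at the subobject m of Y of the right
   adjoint to pulling back subobjects along f : Y -> X. *)
Definition is_forall Y X A B (f : hom Y X) (m : hom A Y) (n : hom B X) : Prop :=
  mono n /\
  forall K (k : hom K X), mono k ->
  forall K' (k' : hom K' Y) (l : hom K' K), is_pullback k' l f k ->
    (factors k n <-> factors k' m).

(* The square   D --q--> B
                |g       |f
                C --p--> A   commutes, and D -> B x_A C is a cover. *)
Definition quasi_pullback D B C' A
    (q : hom D B) (g : hom D C') (f : hom B A) (p : hom C' A) : Prop :=
  exists P (p1 : hom P B) (p2 : hom P C') (u : hom D P),
    is_pullback p1 p2 f p /\ p1 ∘ u = q /\ p2 ∘ u = g /\ cover u.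

Definition covering_square D B C' A
    (q : hom D B) (g : hom D C') (f : hom B A) (p : hom C' A) : Prop :=
  cover p /\ quasi_pullback q g f p.

(* The internal statement "for all a in A and all covers e of B_a there are c
   in the fibre of p over a and h : D_c -> E with e h = q|D_c", written out in
   Kripke-Joyal (stack) semantics: a is a generalized element T -> A, the fibre
   B_a is T x_A B, a cover of B_a is a cover of that object, and existence means
   existence after passing to some cover t : T' -> T. *)
Definition collection_square D B C' A
    (q : hom D B) (g : hom D C') (f : hom B A) (p : hom C' A) : Prop :=
  covering_square q g f p /\
  forall T (a : hom T A) Ba (b1 : hom Ba T) (b2 : hom Ba B),
    is_pullback b1 b2 a f ->
  forall E (e : hom E Ba), cover e ->
  exists T' (t : hom T' T) (c : hom T' C'),
    cover t /\ p ∘ c = a ∘ t /\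
    exists Dc (d1 : hom Dc T') (d2 : hom Dc D) (h : hom Dc E),
      is_pullback d1 d2 c g /\
      b1 ∘ (e ∘ h) = t ∘ d1 /\ b2 ∘ (e ∘ h) = q ∘ d2.

End Notions.

Definition AMC (C : category) (S : map_class C) : Prop :=
  forall (Y X : C) (f : hom Y X), S Y X f ->
  exists (A : C) (q : hom A X), cover q /\
  exists (B : C) (f' : hom B A) (r : hom B Y), is_pullback f' r q f /\
  exists (D C' : C) (s : hom D B) (g : hom D C') (p : hom C' A),
    collection_square s g f' p /\
    S D B s /\ S D C' g /\ S B A f' /\ S C' A p.

Record regular (C : category) : Prop := Regular {
  has_terminal : exists T : C, is_terminal T;
  has_pullbacks : forall (X Y Z : C) (f : hom X Z) (g : hom Y Z),
    exists (P : C) (p1 : hom P X) (p2 : hom P Y), is_pullback p1 p2 f g;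
  has_images : forall (X Y : C) (f : hom X Y),
    exists (I : C) (e : hom X I) (m : hom I Y), cover e /\ mono m /\ m ∘ e = f;
  cover_pullback : forall (P X Y Z : C) (p1 : hom P X) (p2 : hom P Y)
      (f : hom X Z) (g : hom Y Z), is_pullback p1 p2 f g -> cover g -> cover p1
}.

(* Finite joins of subobjects, stable under pullback, need not be postulated:
   they are images of finite sums, which are stable. *)
Record positive_heyting (C : category) : Prop := PositiveHeyting {
  ph_regular : regular C;
  has_initial : exists O : C, is_initial O;
  initial_strict : forall (O X : C), is_initial O -> hom X O -> is_initial X;
  has_coproducts : forall X Y : C,
    exists (P : C) (i1 : hom X P) (i2 : hom Y P), is_coproduct i1 i2;
  coproduct_disjoint : forall (X Y P : C) (i1 : hom X P) (i2 : hom Y P),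
    is_coproduct i1 i2 ->
    mono i1 /\ mono i2 /\
    forall (Q : C) (q1 : hom Q X) (q2 : hom Q Y),
      is_pullback q1 q2 i1 i2 -> is_initial Q;
  coproduct_stable : forall (X Y P : C) (i1 : hom X P) (i2 : hom Y P),
    is_coproduct i1 i2 ->
    forall (Z : C) (f : hom Z P)
      (X' : C) (j1 : hom X' Z) (x : hom X' X)
      (Y' : C) (j2 : hom Y' Z) (y : hom Y' Y),
      is_pullback j1 x f i1 -> is_pullback j2 y f i2 -> is_coproduct j1 j2;
  has_forall : forall (Y X A : C) (f : hom Y X) (m : hom A Y), mono m ->
    exists (B : C) (n : hom B X), is_forall f m n
}.

(* The axioms of van den Berg and Moerdijk for a class of display maps: those
   for a class of small maps, with descent and closure under quotients replaced
   by closure under images. *)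
Record display_maps (C : category) (S : map_class C) : Prop := DisplayMaps {
  dm_pullback : forall (P X Y Z : C) (p1 : hom P X) (p2 : hom P Y)
      (f : hom X Z) (g : hom Y Z), is_pullback p1 p2 f g -> S Y Z g -> S P X p1;
  dm_sum : forall (X Y X' Y' : C) (f : hom X Y) (f' : hom X' Y')
      (P Q : C) (i1 : hom X P) (i2 : hom X' P) (j1 : hom Y Q) (j2 : hom Y' Q)
      (h : hom P Q),
    is_coproduct i1 i2 -> is_coproduct j1 j2 ->
    h ∘ i1 = j1 ∘ f -> h ∘ i2 = j2 ∘ f' ->
    S X Y f -> S X' Y' f' -> S P Q h;
  dm_empty : forall (O T : C) (f : hom O T),
    is_initial O -> is_terminal T -> S O T f;
  dm_one : forall T : C, is_terminal T -> S T T (idm T);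
  dm_two : forall (T B : C) (i1 i2 : hom T B) (f : hom B T),
    is_terminal T -> is_coproduct i1 i2 -> S B T f;
  dm_comp : forall (X Y Z : C) (g : hom Y Z) (f : hom X Y),
    S Y Z g -> S X Y f -> S X Z (g ∘ f);
  dm_collection : forall (Y X A : C) (p : hom Y X) (f : hom X A),
    cover p -> S X A f ->
    exists (Z B : C) (k : hom Z Y) (g : hom Z B) (h : hom B A),
      S Z B g /\ covering_square (p ∘ k) g f h;
  dm_heyting : forall (Y X A B : C) (f : hom Y X) (m : hom A Y) (n : hom B X),
    S Y X f -> mono m -> S A Y m -> is_forall f m n -> S B X n;
  dm_diagonal : forall (X P : C) (p1 p2 : hom P X) (d : hom X P),
    is_product p1 p2 -> p1 ∘ d = idm X -> p2 ∘ d = idm X -> S X P d;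
  dm_image : forall (Z Y X : C) (e : hom Z Y) (m : hom Y X),
    cover e -> mono m -> S Z X (m ∘ e) -> S Y X m
}.

Record display_category := DisplayCategory {
  dcat :> category;
  display : map_class dcat;
  dcat_positive_heyting : positive_heyting dcat;
  display_axioms : display_maps display
}.

Arguments display {D X Y} f : rename.

Section Covers.
Context {C : category} (regC : regular C).
Implicit Types X Y Z W P : C.

Lemma cover_epi X Y (e : hom X Y) : cover e ->
  forall Z (u v : hom Y Z), u ∘ e = v ∘ e -> u = v.
Proof.
move=> [W [w1 [w2 [ew ue]]]] Z u v uv.
have E : (u ∘ e) ∘ w1 = (u ∘ e) ∘ w2 by rewrite -!compA ew.
have [h [_ hu]] := ue _ _ E.
by rewrite -(hu u) // -(hu v).
Qed.

Lemma cover_orth X Y A B (e : hom X Y) (m : hom A B) (k : hom X A)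
    (l : hom Y B) : cover e -> mono m -> m ∘ k = l ∘ e ->
  exists h : hom Y A, h ∘ e = k /\ m ∘ h = l.
Proof.
move=> ce mm E; have [W [u [v [ew ue]]]] := ce.
have kuv : k ∘ u = k ∘ v.
  by apply: mm; rewrite !compA E -!compA ew.
have [h [he _]] := ue _ _ kuv.
exists h; split=> //; apply: (cover_epi ce).
by rewrite -compA he.
Qed.

Lemma cover_id X : cover (idm X).
Proof.
exists X, (idm X), (idm X); split=> // Z k _; exists k.
by split=> [|h]; rewrite comp_idr.
Qed.

Lemma cover_comp X Y Z (e' : hom Y Z) (e : hom X Y) :
  cover e' -> cover e -> cover (e' ∘ e).
Proof.
move=> ce' ce; have [I [k [m [ck [mm E]]]]] := has_images regC (e' ∘ e).
have [d [_ md]] := cover_orth ce mm E.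
have E' : m ∘ d = idm Z ∘ e' by rewrite comp_idl.
have [s [_ ms]] := cover_orth ce' mm E'.
have sm : s ∘ m = idm I by apply: mm; rewrite compA ms comp_idl comp_idr.
have [W [u [v [kuv uk]]]] := ck.
exists W, u, v; rewrite -E; split; first by rewrite -!compA kuv.
move=> V l luv; have [h [hk hu]] := uk _ _ luv.
exists (h ∘ s); split.
  by rewrite compA -(compA h) sm comp_idr.
move=> h' hh'; have -> : h = h' ∘ m by apply: hu; rewrite -compA.
by rewrite -compA ms comp_idr.
Qed.

Lemma cover_lift X Y Z (e : hom X Y) (a : hom Z Y) : cover e ->
  exists W (e' : hom W Z) (b : hom W X), cover e' /\ e ∘ b = a ∘ e'.
Proof.
move=> ce; have [P [p1 [p2 pb]]] := has_pullbacks regC a e.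
exists P, p1, p2; split; first exact: (cover_pullback regC pb ce).
by have [-> _] := pb.
Qed.

Lemma has_products X Y :
  exists P (p1 : hom P X) (p2 : hom P Y), is_product p1 p2.
Proof.
have [T tT] := has_terminal regC.
have [f _] := tT X; have [g _] := tT Y.
have [P [p1 [p2 [_ pb]]]] := has_pullbacks regC f g.
exists P, p1, p2 => W a b; apply: pb.
by have [k kk] := tT W; rewrite (kk (f ∘ a)) (kk (g ∘ b)).
Qed.

Lemma product_ext X Y P (p1 : hom P X) (p2 : hom P Y) W (u v : hom W P) :
  is_product p1 p2 -> p1 ∘ u = p1 ∘ v -> p2 ∘ u = p2 ∘ v -> u = v.
Proof.
move=> pr E1 E2; have [h [_ hu]] := pr _ (p1 ∘ v) (p2 ∘ v).
by rewrite -(hu u) // (hu v).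
Qed.

End Covers.

(* A subobject of X x Y is encoded by its generalized elements: a family F of
   relations between the maps W -> X and W -> Y consisting exactly of the pairs
   (a, b) for which <a, b> factors through a given mono m into a product of X
   and Y.  By extensionality, two such families are equal iff they come from the
   same subobject. *)
Definition relation_family (C : category) (X Y : C) :=
  forall W : C, hom W X -> hom W Y -> Prop.

Definition tabulates (C : category) (X Y P G : C) (p1 : hom P X) (p2 : hom P Y)
    (m : hom G P) (F : relation_family X Y) : Prop :=
  is_product p1 p2 /\ mono m /\
  forall W (a : hom W X) (b : hom W Y),
    F W a b <-> exists h : hom W G, p1 ∘ (m ∘ h) = a /\ p2 ∘ (m ∘ h) = b.

Definition is_subobject (C : category) (X Y : C) (F : relation_family X Y) :=
  exists (P G : C) (p1 : hom P X) (p2 : hom P Y) (m : hom G P),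
    tabulates p1 p2 m F.

Definition is_bounded (D : display_category) (X Y : D)
    (F : relation_family X Y) :=
  exists (P G : D) (p1 : hom P X) (p2 : hom P Y) (m : hom G P),
    tabulates p1 p2 m F /\ display m.

Record bounded_eqrel (D : display_category) := BoundedEqrel {
  carrier : D;
  eqrel : relation_family carrier carrier;
  eqrel_bounded : is_bounded eqrel;
  eqrel_refl : forall W (a : hom W carrier), eqrel a a;
  eqrel_sym : forall W (a b : hom W carrier), eqrel a b -> eqrel b a;
  eqrel_trans : forall W (a b c : hom W carrier),
    eqrel a b -> eqrel b c -> eqrel a c
}.

Arguments eqrel {D} X [W] a b : rename.

(* Totality "for all x there is y with F(x, y)" is interpreted in the internal
   logic: y exists after passing to a cover. *)
Record functional_relation (D : display_category) (X Y : bounded_eqrel D) :=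
  FunctionalRelation {
  graph : relation_family (carrier X) (carrier Y);
  graph_subobject : is_subobject graph;
  graph_compat : forall W (a a' : hom W (carrier X)) (b b' : hom W (carrier Y)),
    eqrel X a a' -> eqrel Y b b' -> graph a b -> graph a' b';
  graph_single : forall W (a : hom W (carrier X)) (b b' : hom W (carrier Y)),
    graph a b -> graph a b' -> eqrel Y b b';
  graph_total : forall W (a : hom W (carrier X)),
    exists (W' : D) (e : hom W' W) (b : hom W' (carrier Y)),
      cover e /\ graph (a ∘ e) b
}.

Arguments graph {D X Y} F [W] a b : rename.

(* "There is y with F(x, y) and G(y, z)", again in the internal logic. *)
Definition rel_comp (C : category) (X Y Z : C)
    (G : relation_family Y Z) (F : relation_family X Y) : relation_family X Z :=
  fun W a c => exists (W' : C) (e : hom W' W) (b : hom W' Y),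
    cover e /\ F W' (a ∘ e) b /\ G W' b (c ∘ e).

Section Relations.
Context {C : category} (regC : regular C).
Implicit Types X Y Z W P : C.

Lemma relation_ext X Y (F G : relation_family X Y) :
  (forall W (a : hom W X) (b : hom W Y), F W a b <-> G W a b) -> F = G.
Proof.
move=> FG; apply: functional_extensionality_dep => W.
apply: functional_extensionality => a; apply: functional_extensionality => b.
exact: propositional_extensionality.
Qed.

Lemma subobject_stable X Y (F : relation_family X Y) W W' (t : hom W' W)
    (a : hom W X) (b : hom W Y) :
  is_subobject F -> F W a b -> F W' (a ∘ t) (b ∘ t).
Proof.
move=> [P [G [p1 [p2 [m [_ [_ tF]]]]]]] /tF [h [<- <-]].
by apply/tF; exists (h ∘ t); rewrite !compA.
Qed.

Lemma subobject_local X Y (F : relation_family X Y) W W' (e : hom W' W)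
    (a : hom W X) (b : hom W Y) :
  is_subobject F -> cover e -> F W' (a ∘ e) (b ∘ e) -> F W a b.
Proof.
move=> [P [G [p1 [p2 [m [pr [mm tF]]]]]]] ce /tF [h [h1 h2]].
have [ab [[ab1 ab2] _]] := pr _ a b.
have E : m ∘ h = ab ∘ e.
  by apply: (product_ext pr); rewrite ?h1 ?h2 compA ?ab1 ?ab2.
have [k [_ mk]] := cover_orth ce mm E.
by apply/tF; exists k; rewrite mk.
Qed.

Lemma subobject_comp X Y Z (G : relation_family Y Z) (F : relation_family X Y) :
  is_subobject G -> is_subobject F -> is_subobject (rel_comp G F).
Proof.
move=> [Q [K [q1 [q2 [n [_ [_ tG]]]]]]] [P [H [p1 [p2 [m [_ [_ tF]]]]]]].
have [L [l1 [l2 [El pb]]]] := has_pullbacks regC (p2 ∘ m) (q1 ∘ n).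
have [R [r1 [r2 pr]]] := has_products regC X Z.
have [f [[f1 f2] _]] := pr _ (p1 ∘ m ∘ l1) (q2 ∘ n ∘ l2).
have [I [k [i [ck [mi E]]]]] := has_images regC f.
exists R, I, r1, r2, i; split=> //; split=> // W a c; split.
- move=> [W' [e [b [ce [/tF [u [u1 u2]] /tG [v [v1 v2]]]]]]].
  have Euv : p2 ∘ m ∘ u = q1 ∘ n ∘ v by rewrite -!compA u2 v1.
  have [w [[w1 w2] _]] := pb _ _ _ Euv.
  have [ac [[ac1 ac2] _]] := pr _ a c.
  have Ei : i ∘ (k ∘ w) = ac ∘ e.
    apply: (product_ext pr); rewrite !compA ?ac1 ?ac2 -!(compA _ i) E ?f1 ?f2.
      by rewrite -compA w1 -compA u1.
    by rewrite -compA w2 -compA v2.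
  have [h [_ ih]] := cover_orth ce mi Ei.
  by exists h; rewrite ih.
- move=> [h [<- <-]].
  have [W' [e [w [ce Ew]]]] := cover_lift regC h ck.
  exists W', e, (p2 ∘ m ∘ l1 ∘ w); split=> //; split.
  + apply/tF; exists (l1 ∘ w); rewrite !compA; split=> //.
    by rewrite -!(compA _ h) -Ew -f1 -E !compA.
  + apply/tG; exists (l2 ∘ w); rewrite !compA El; split=> //.
    by rewrite -!(compA _ h) -Ew -f2 -E !compA.
Qed.

End Relations.

Section Completion.
Variable D : display_category.
Implicit Types X Y Z : bounded_eqrel D.

Let regD : regular D := ph_regular (dcat_positive_heyting D).

Lemma bounded_subobject (X Y : D) (F : relation_family X Y) :
  is_bounded F -> is_subobject F.
Proof.
by move=> [P [G [p1 [p2 [m [tF _]]]]]]; exists P, G, p1, p2, m.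
Qed.

Lemma functional_relation_ext X Y (F G : functional_relation X Y) :
  (forall W (a : hom W (carrier X)) (b : hom W (carrier Y)),
    graph F a b <-> graph G a b) -> F = G.
Proof.
case: F G => [F f1 f2 f3 f4] [G g1 g2 g3 g4] /= /relation_ext FG.
by case: _ / FG g1 g2 g3 g4 => g1 g2 g3 g4; f_equal; apply: proof_irrelevance.
Qed.

Lemma eqrel_compat X W (a a' b b' : hom W (carrier X)) :
  eqrel X a a' -> eqrel X b b' -> eqrel X a b -> eqrel X a' b'.
Proof.
move=> aa' bb' ab; apply: eqrel_trans bb'; apply: eqrel_trans ab.
exact: eqrel_sym.
Qed.

Lemma eqrel_single X W (a b b' : hom W (carrier X)) :
  eqrel X a b -> eqrel X a b' -> eqrel X b b'.
Proof. move=> ab; apply: eqrel_trans; exact: eqrel_sym. Qed.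

Lemma eqrel_total X W (a : hom W (carrier X)) :
  exists (W' : D) (e : hom W' W) (b : hom W' (carrier X)),
    cover e /\ eqrel X (a ∘ e) b.
Proof.
exists W, (idm W), a; split; first exact: cover_id.
rewrite comp_idr; exact: eqrel_refl.
Qed.

Definition fr_id X : functional_relation X X :=
  FunctionalRelation (bounded_subobject (eqrel_bounded X))
    (@eqrel_compat X) (@eqrel_single X) (@eqrel_total X).

Lemma eqrel_stable (X : bounded_eqrel D) W W' (t : hom W' W)
    (a b : hom W (carrier X)) : eqrel X a b -> eqrel X (a ∘ t) (b ∘ t).
Proof. exact: subobject_stable (bounded_subobject (eqrel_bounded X)). Qed.

Section Composition.
Variables (X Y Z : bounded_eqrel D).
Variables (G : functional_relation Y Z) (F : functional_relation X Y).
Let GF := rel_comp (@graph _ _ _ G) (@graph _ _ _ F).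

Lemma fr_comp_compat W (a a' : hom W (carrier X)) (c c' : hom W (carrier Z)) :
  eqrel X a a' -> eqrel Z c c' -> GF a c -> GF a' c'.
Proof.
move=> aa' cc' [W' [e [b [ce [Fab Gbc]]]]].
exists W', e, b; split=> //; split.
  by apply: (graph_compat _ _ Fab); [exact: eqrel_stable | exact: eqrel_refl].
by apply: (graph_compat _ _ Gbc); [exact: eqrel_refl | exact: eqrel_stable].
Qed.

Lemma fr_comp_single W (a : hom W (carrier X)) (c c' : hom W (carrier Z)) :
  GF a c -> GF a c' -> eqrel Z c c'.
Proof.
move=> [W1 [e1 [b1 [ce1 [F1 G1]]]]] [W2 [e2 [b2 [ce2 [F2 G2]]]]].
have [V [v1 [v2 [cv1 E]]]] := cover_lift regD e1 ce2.
apply: (subobject_local (bounded_subobject (eqrel_bounded Z))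
          (cover_comp regD ce1 cv1)).
have {}F1 := subobject_stable v1 (graph_subobject F) F1.
have {}G1 := subobject_stable v1 (graph_subobject G) G1.
have {}F2 := subobject_stable v2 (graph_subobject F) F2.
have {}G2 := subobject_stable v2 (graph_subobject G) G2.
move: F2 G2; rewrite -!compA E => F2 G2; rewrite -!compA in F1 G1.
have bb := graph_single F1 F2.
apply: (graph_single _ G2); apply: (graph_compat bb _ G1); exact: eqrel_refl.
Qed.

Lemma fr_comp_total W (a : hom W (carrier X)) :
  exists (W' : D) (e : hom W' W) (c : hom W' (carrier Z)),
    cover e /\ GF (a ∘ e) c.
Proof.
have [W1 [e1 [b [ce1 Fab]]]] := graph_total F a.
have [W2 [e2 [c [ce2 Gbc]]]] := graph_total G b.
exists W2, (e1 ∘ e2), c; split; first exact: cover_comp.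
exists W2, (idm W2), (b ∘ e2); rewrite !comp_idr compA.
split; first exact: cover_id.
by split=> //; apply: (subobject_stable e2 (graph_subobject F)).
Qed.

Definition fr_comp : functional_relation X Z :=
  FunctionalRelation
    (subobject_comp regD (graph_subobject G) (graph_subobject F))
    fr_comp_compat fr_comp_single fr_comp_total.

End Composition.

Lemma fr_idl X Y (F : functional_relation X Y) : fr_comp (fr_id Y) F = F.
Proof.
apply: functional_relation_ext => W a b /=; split.
- move=> [W' [e [c [ce [Fac /= cb]]]]].
  apply: (subobject_local (graph_subobject F) ce).
  exact: (graph_compat (eqrel_refl _) cb Fac).
- move=> Fab; exists W, (idm W), b; rewrite !comp_idr.
  split; first exact: cover_id.
  by split=> //=; apply: eqrel_refl.
Qed.

Lemma fr_idr X Y (F : functional_relation X Y) : fr_comp F (fr_id X) = F.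
Proof.
apply: functional_relation_ext => W a b /=; split.
- move=> [W' [e [c [ce [/= ac Fcb]]]]].
  apply: (subobject_local (graph_subobject F) ce).
  exact: (graph_compat (eqrel_sym ac) (eqrel_refl _) Fcb).
- move=> Fab; exists W, (idm W), a; rewrite !comp_idr.
  split; first exact: cover_id.
  by split=> //=; apply: eqrel_refl.
Qed.

Lemma fr_compA X Y Z V (H : functional_relation Z V)
    (G : functional_relation Y Z) (F : functional_relation X Y) :
  fr_comp H (fr_comp G F) = fr_comp (fr_comp H G) F.
Proof.
apply: functional_relation_ext => W a d /=; split.
- move=> [W1 [e1 [c [ce1 [[W2 [e2 [b [ce2 [Fab Gbc]]]]] Hcd]]]]].
  exists W2, (e1 ∘ e2), b; split; first exact: cover_comp.
  rewrite !compA; split=> //.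
  exists W2, (idm W2), (c ∘ e2); rewrite !comp_idr.
  split; first exact: cover_id.
  by split=> //; apply: (subobject_stable e2 (graph_subobject H)).
- move=> [W1 [e1 [b [ce1 [Fab [W2 [e2 [c [ce2 [Gbc Hcd]]]]]]]]]].
  exists W2, (e1 ∘ e2), c; split; first exact: cover_comp.
  rewrite !compA; split=> //.
  exists W2, (idm W2), (b ∘ e2); rewrite !comp_idr.
  split; first exact: cover_id.
  by split=> //; apply: (subobject_stable e2 (graph_subobject F)).
Qed.

(* The bounded exact completion: bounded equivalence relations (X, R), standing
   for the quotient X / R, and functional relations between them. *)
Definition exact_completion : category :=
  Category fr_idl fr_idr fr_compA.

Lemma diagonal_bounded (X : D) :
  @is_bounded D X X (fun W (a b : hom W X) => a = b).
Proof.
have [P [p1 [p2 pr]]] := has_products regD X X.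
have [d [[d1 d2] _]] := pr _ (idm X) (idm X).
exists P, X, p1, p2, d; split; last first.
  exact: (dm_diagonal (display_axioms D) pr d1 d2).
split=> //; split.
  by move=> W u v E; rewrite -(comp_idl u) -(comp_idl v) -d1 -!compA E.
move=> W a b; split; first by move=> <-; exists a; rewrite !compA d1 d2 comp_idl.
by move=> [h []]; rewrite !compA d1 d2 comp_idl => -> ->.
Qed.

Definition yo (X : D) : exact_completion :=
  BoundedEqrel (@diagonal_bounded X)
    (fun W a => eq_refl) (fun W => @eq_sym _) (fun W => @eq_trans _).

Section YonedaMap.
Variables (X Y : D) (f : hom X Y).

Lemma map_graph_subobject :
  @is_subobject D X Y (fun W (a : hom W X) (b : hom W Y) => f ∘ a = b).
Proof.
have [P [p1 [p2 pr]]] := has_products regD X Y.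
have [d [[d1 d2] _]] := pr _ (idm X) f.
exists P, X, p1, p2, d; split=> //; split.
  by move=> W u v E; rewrite -(comp_idl u) -(comp_idl v) -d1 -!compA E.
move=> W a b; split; first by move=> <-; exists a; rewrite !compA d1 d2 comp_idl.
by move=> [h []]; rewrite !compA d1 d2 comp_idl => <- <-.
Qed.

Lemma map_graph_compat W (a a' : hom W X) (b b' : hom W Y) :
  a = a' -> b = b' -> f ∘ a = b -> f ∘ a' = b'.
Proof. by move=> <- <-. Qed.

Lemma map_graph_single W (a : hom W X) (b b' : hom W Y) :
  f ∘ a = b -> f ∘ a = b' -> b = b'.
Proof. by move=> <-. Qed.

Lemma map_graph_total W (a : hom W X) :
  exists (W' : D) (e : hom W' W) (b : hom W' Y), cover e /\ f ∘ (a ∘ e) = b.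
Proof.
exists W, (idm W), (f ∘ a); rewrite comp_idr; split=> //; exact: cover_id.
Qed.

Definition yo_map : hom (yo X) (yo Y) :=
  @FunctionalRelation D (yo X) (yo Y) _ map_graph_subobject
    map_graph_compat map_graph_single map_graph_total.

End YonedaMap.

Lemma yo_map_id (X : D) : yo_map (idm X) = idm (yo X).
Proof.
by apply: functional_relation_ext => W a b; rewrite /= comp_idl.
Qed.

Lemma yo_map_comp (X Y Z : D) (g : hom Y Z) (f : hom X Y) :
  yo_map (g ∘ f) = yo_map g ∘ yo_map f.
Proof.
apply: functional_relation_ext => W a c; split=> /= [<-|].
  exists W, (idm W), (f ∘ a); rewrite !comp_idr compA.
  by split=> //; apply: cover_id.
move=> [W' [e [b [ce [/= <- E]]]]].
by apply: (cover_epi ce); rewrite -E !compA.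
Qed.

Lemma yo_map_inj (X Y : D) (f g : hom X Y) : yo_map f = yo_map g -> f = g.
Proof.
move=> E; have : graph (yo_map f) (idm X) f by rewrite /= comp_idr.
by rewrite E /= comp_idr.
Qed.

Lemma yo_map_full (X Y : D) (F : hom (yo X) (yo Y)) :
  exists f : hom X Y, yo_map f = F.
Proof.
have [W [e [b [ce Feb]]]] := graph_total F (idm X); rewrite comp_idl in Feb.
have [V [u [v [euv ue]]]] := ce.
have buv : b ∘ u = b ∘ v.
  have F1 := subobject_stable u (graph_subobject F) Feb.
  have F2 := subobject_stable v (graph_subobject F) Feb.
  by rewrite euv in F1; apply: (graph_single F1 F2).
have [f [fe _]] := ue _ _ buv; exists f.
have Ff : graph F (idm X) f.
  by apply: (subobject_local (graph_subobject F) ce); rewrite comp_idl fe.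
have Fa W0 (a : hom W0 X) : graph F a (f ∘ a).
  by have := subobject_stable a (graph_subobject F) Ff; rewrite comp_idl.
apply: functional_relation_ext => W0 a c; split=> [/= <- //|Fac].
exact: (graph_single (Fa _ a) Fac).
Qed.

(* The maps covered by the image of a display map. *)
Definition small : map_class exact_completion := fun B A f =>
  exists (B' A' : D) (f' : hom B' A') (q : hom (yo B') B) (p : hom (yo A') A),
    display f' /\ covering_square q (yo_map f') f p.

End Completion.

(* Main.v *)
From Corelib Require Import ssreflect.
Require Import Defs.

(* An object of the completion is handled through the generalized elements of
   its carrier: covers become maps that are surjective up to refining the stage
   by a cover, and pullbacks and quasi-pullbacks have similar descriptions.
   A small map over X is covered by some f' : B' -> A'.  Multiple choice in D
   gives A0 -> A' and a collection square on B0 = A0 x_A' B'; its image under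
   the embedding, composed with the cover u : yo B0 -> B onto the pullback B of
   the given map, is again a collection square, since a cover of a fibre of B
   pulls back to a cover of a fibre of B0, which can be refined by one in D.
   The map u itself need not be the embedding of a map, but any map k from yo P
   to an object B over yo A is small if P -> A is a display map: by collection
   one covers it by the object of those (p, b) over A with k p = b, which is cut
   out by the bounded equivalence relation of B once k is given by
   representatives. *)

Set Implicit Arguments.
Unset Strict Implicit.
Unset Printing Implicit Defensive.
Local Open Scope cat_scope.

(** * Subobjects of products in [D]: comprehension, preimages, meets, converses *)

Section Subobjects.
Context {D : display_category}.
Implicit Types X Y Z W P : D.

Let regD : regular D := ph_regular (dcat_positive_heyting D).

Lemma pullback_mono X Y Z P (p1 : hom P X) (p2 : hom P Y) (f : hom X Z)
    (m : hom Y Z) : is_pullback p1 p2 f m -> mono m -> mono p1.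
Proof.
move=> [E pb] mm W u v uv.
have E' : p2 ∘ u = p2 ∘ v by apply: mm; rewrite !compA -E -!compA uv.
have [h [_ hu]] := pb _ (p1 ∘ v) (p2 ∘ v) ltac:(by rewrite !compA E).
by rewrite -(hu u) // (hu v).
Qed.

(** Pulling the tabulating mono back along the pairing of [x] and [y] cuts out the part of [Z] where
    the relation holds; pullback preserves monos and display maps. *)
Lemma tabulates_comprehension X Y P G (p1 : hom P X) (p2 : hom P Y)
    (m : hom G P) (F : relation_family X Y) Z (x : hom Z X) (y : hom Z Y) :
  tabulates p1 p2 m F ->
  exists Z' (j : hom Z' Z), mono j /\ (display m -> display j) /\
    forall W (z : hom W Z), F W (x ∘ z) (y ∘ z) <-> exists h, j ∘ h = z.
Proof.
move=> [pr [mm tF]].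
have [xy [[xy1 xy2] _]] := pr _ x y.
have [Z' [j [t pb]]] := has_pullbacks regD xy m.
exists Z', j; split; first exact: (pullback_mono pb mm).
split; first exact: (dm_pullback (display_axioms D) pb).
case: pb => E pb W z; split.
- move=> /tF [h [h1 h2]].
  have E' : xy ∘ z = m ∘ h.
    by apply: (product_ext pr); rewrite compA ?xy1 ?xy2.
  by have [w [[wz _] _]] := pb _ _ _ E'; exists w.
- move=> [h <-]; apply/tF; exists (t ∘ h).
  by rewrite (compA m) -E -xy1 -xy2 !compA.
Qed.

Lemma tabulates_preimage X Y P G (p1 : hom P X) (p2 : hom P Y)
    (m : hom G P) (F : relation_family X Y) X' Y' (f : hom X' X)
    (g : hom Y' Y) :
  tabulates p1 p2 m F ->
  exists P' G' (p1' : hom P' X') (p2' : hom P' Y') (m' : hom G' P'),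
    tabulates p1' p2' m' (fun W a b => F W (f ∘ a) (g ∘ b)) /\
    (display m -> display m').
Proof.
move=> tF; have [P' [q1 [q2 pr]]] := has_products regD X' Y'.
have [G' [j [mj [dj cj]]]] := tabulates_comprehension (f ∘ q1) (g ∘ q2) tF.
exists P', G', q1, q2, j; split=> //; split=> //; split=> // W a b.
have [ab [[<- <-] _]] := pr _ a b; rewrite !compA; split.
- by move=> /cj [h <-]; exists h; rewrite !compA.
- move=> [h [h1 h2]]; apply/cj; exists h.
  exact: (product_ext pr).
Qed.

(** The second relation is cut out inside the tabulation [G] of the first, so the meet is a
    composite of monos, and of display maps if both relations are bounded. *)
Lemma tabulates_meet X Y P G (p1 : hom P X) (p2 : hom P Y) (m : hom G P)
    P' G' (p1' : hom P' X) (p2' : hom P' Y) (m' : hom G' P')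
    (F F' : relation_family X Y) :
  tabulates p1 p2 m F -> tabulates p1' p2' m' F' ->
  exists H (n : hom H P), tabulates p1 p2 n (fun W a b => F W a b /\ F' W a b)
    /\ (display m -> display m' -> display n).
Proof.
move=> [pr [mm tF]] tF'.
have [H [j [mj [dj cj]]]] := tabulates_comprehension (p1 ∘ m) (p2 ∘ m) tF'.
exists H, (m ∘ j); split; last first.
  by move=> dm /dj; apply: (dm_comp (display_axioms D)).
split=> //; split.
  by move=> W u v; rewrite -!compA => /mm /mj.
move=> W a b; split.
- move=> [/tF [h [<- <-]]]; rewrite !compA => /cj [k <-].
  by exists k; rewrite !compA.
- move=> [h [<- <-]]; split.
    by apply/tF; exists (j ∘ h); rewrite !compA.
  by rewrite -!compA (compA p1) (compA p2); apply/cj; exists h.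
Qed.

Lemma subobject_preimage X Y (F : relation_family X Y) X' Y' (f : hom X' X)
    (g : hom Y' Y) :
  is_subobject F -> is_subobject (fun W a b => F W (f ∘ a) (g ∘ b)).
Proof.
move=> [P [G [p1 [p2 [m tF]]]]].
have [P' [G' [q1 [q2 [m' [tF' _]]]]]] := tabulates_preimage f g tF.
by exists P', G', q1, q2, m'.
Qed.

Lemma bounded_preimage X Y (F : relation_family X Y) X' Y' (f : hom X' X)
    (g : hom Y' Y) :
  is_bounded F -> is_bounded (fun W a b => F W (f ∘ a) (g ∘ b)).
Proof.
move=> [P [G [p1 [p2 [m [tF dm]]]]]].
have [P' [G' [q1 [q2 [m' [tF' dm']]]]]] := tabulates_preimage f g tF.
by exists P', G', q1, q2, m'; split=> //; apply: dm'.
Qed.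

Lemma subobject_meet X Y (F F' : relation_family X Y) :
  is_subobject F -> is_subobject F' ->
  is_subobject (fun W a b => F W a b /\ F' W a b).
Proof.
move=> [P [G [p1 [p2 [m tF]]]]] [P' [G' [p1' [p2' [m' tF']]]]].
by have [H [n [tn _]]] := tabulates_meet tF tF'; exists P, H, p1, p2, n.
Qed.

Lemma bounded_meet X Y (F F' : relation_family X Y) :
  is_bounded F -> is_bounded F' ->
  is_bounded (fun W a b => F W a b /\ F' W a b).
Proof.
move=> [P [G [p1 [p2 [m [tF dm]]]]]] [P' [G' [p1' [p2' [m' [tF' dm']]]]]].
have [H [n [tn dn]]] := tabulates_meet tF tF'.
by exists P, H, p1, p2, n; split=> //; apply: dn.
Qed.

Lemma subobject_converse X Y (F : relation_family X Y) :
  is_subobject F -> @is_subobject D Y X (fun W a b => F W b a).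
Proof.
move=> [P [G [p1 [p2 [m [pr [mm tF]]]]]]].
exists P, G, p2, p1, m; split; last split=> //.
  move=> W a b; have [h [[h1 h2] hu]] := pr _ b a.
  by exists h; split=> // h' [h1' h2']; apply: hu.
move=> W a b; split; first by move=> /tF [h [? ?]]; exists h.
by move=> [h [? ?]]; apply/tF; exists h.
Qed.

Lemma quasi_pullback_lift X Y Z P (q : hom P X) (g : hom P Y) (f : hom X Z)
    (p : hom Y Z) W (x : hom W X) (y : hom W Y) :
  quasi_pullback q g f p -> f ∘ x = p ∘ y ->
  exists W' (e : hom W' W) (z : hom W' P),
    cover e /\ q ∘ z = x ∘ e /\ g ∘ z = y ∘ e.
Proof.
move=> [Q [p1 [p2 [u [[_ pb] [<- [<- cu]]]]]]] /pb [h [[<- <-] _]].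
have [W' [e [z [ce E]]]] := cover_lift regD h cu.
by exists W', e, z; split=> //; rewrite -!compA E.
Qed.

End Subobjects.

(** * Generalized elements and maps of the completion *)

Section Elements.
Variable D : display_category.
Let E := exact_completion D.
Implicit Types X Y Z P : E.

Let regD : regular D := ph_regular (dcat_positive_heyting D).

(** These are representatives: elements of the quotient at stage [W] are compared by [eqrel X], not
    by equality. *)
Definition element X (W : D) := @hom D W (@carrier D X).

Lemma graph_stable X Y (F : hom X Y) (W W' : D) (t : hom W' W)
    (a : element X W) (b : element Y W) :
  graph F a b -> graph F (a ∘ t) (b ∘ t).
Proof. exact: subobject_stable (graph_subobject F). Qed.

Lemma graph_local X Y (F : hom X Y) (W W' : D) (e : hom W' W)
    (a : element X W) (b : element Y W) :
  cover e -> graph F (a ∘ e) (b ∘ e) -> graph F a b.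
Proof. exact: subobject_local (graph_subobject F). Qed.

Lemma graph_congl X Y (F : hom X Y) (W : D) (a a' : element X W)
    (b : element Y W) : eqrel X a a' -> graph F a b -> graph F a' b.
Proof. move=> aa'; apply: (graph_compat aa'); exact: eqrel_refl. Qed.

Lemma graph_congr X Y (F : hom X Y) (W : D) (a : element X W)
    (b b' : element Y W) : eqrel Y b b' -> graph F a b -> graph F a b'.
Proof. apply: graph_compat; exact: eqrel_refl. Qed.

Lemma graph_comp X Y Z (G : hom Y Z) (F : hom X Y) (W : D) (a : element X W)
    (b : element Y W) (c : element Z W) :
  graph F a b -> graph G b c -> graph (G ∘ F) a c.
Proof.
move=> Fab Gbc; exists W, (idm W), b; rewrite !comp_idr.
by split; first exact: cover_id.
Qed.

(** Single-valuedness of [F] lets the intermediate value, which composition provides only on a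
    cover, be replaced by one known in advance. *)
Lemma graph_comp_elim X Y Z (G : hom Y Z) (F : hom X Y) (W : D)
    (a : element X W) (b : element Y W) (c : element Z W) :
  graph F a b -> graph (G ∘ F) a c -> graph G b c.
Proof.
move=> Fab [W' [e [b' [ce [Fab' Gb'c]]]]]; apply: (graph_local ce).
by apply: graph_congl Gb'c; apply: (graph_single Fab'); apply: graph_stable.
Qed.

(* Comparable functional relations are equal, so one inclusion suffices. *)
Lemma graph_le_eq X Y (F G : hom X Y) :
  (forall (W : D) (a : element X W) (b : element Y W),
     graph F a b -> graph G a b) -> F = G.
Proof.
move=> FG; apply: functional_relation_ext => W a b; split; first exact: FG.
move=> Gab; have [W' [e [b' [ce Fab']]]] := graph_total F a.
apply: (graph_local ce); apply: (graph_congr _ Fab').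
by apply: (graph_single (FG _ _ _ Fab')); apply: graph_stable.
Qed.

(** One inclusion is enough, and since [H] is local for covers the intermediate element may be
    assumed to exist at the given stage. *)
Lemma graph_comp_local X Y Z (G : hom Y Z) (F : hom X Y) (H : hom X Z) :
  (forall (W : D) (a : element X W) (b : element Y W) (c : element Z W),
    graph F a b -> graph G b c -> graph H a c) -> G ∘ F = H.
Proof.
move=> GFH; apply: graph_le_eq => W a c [W' [e [b [ce [Fab Gbc]]]]].
by apply: (graph_local ce); apply: (GFH _ _ b).
Qed.

(** * Maps of the completion given by maps in [D] *)

Section Induced.
Variables (X Y : E) (f : element Y (@carrier D X)).
Hypothesis f_eqrel : forall (W : D) (a b : element X W),
  eqrel X a b -> eqrel Y (f ∘ a) (f ∘ b).

Lemma induced_subobject : @is_subobject D (@carrier D X) (@carrier D Y)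
  (fun W a b => eqrel Y (f ∘ a) b).
Proof.
have := subobject_preimage f (idm _) (bounded_subobject (eqrel_bounded Y)).
rewrite (_ : (fun _ _ _ => _) = (fun W a b => eqrel Y (f ∘ a) b)) //.
by apply: relation_ext => W a b; rewrite comp_idl.
Qed.

Lemma induced_compat (W : D) (a a' : element X W) (b b' : element Y W) :
  eqrel X a a' -> eqrel Y b b' -> eqrel Y (f ∘ a) b -> eqrel Y (f ∘ a') b'.
Proof. by move=> /f_eqrel; apply: eqrel_compat. Qed.

Lemma induced_single (W : D) (a : element X W) (b b' : element Y W) :
  eqrel Y (f ∘ a) b -> eqrel Y (f ∘ a) b' -> eqrel Y b b'.
Proof. exact: eqrel_single. Qed.

Lemma induced_total (W : D) (a : element X W) :
  exists (W' : D) (e : hom W' W) (b : element Y W'),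
    cover e /\ eqrel Y (f ∘ (a ∘ e)) b.
Proof.
by have [W' [e [b]]] := eqrel_total (f ∘ a); rewrite -compA; exists W', e, b.
Qed.

Definition induced : @hom E X Y :=
  FunctionalRelation induced_subobject induced_compat induced_single
    induced_total.

End Induced.

(** Any map of [D] out of [W] respects the equivalence relation of [yo W], which is equality. By
    [yo_local_element], every map from [yo W] has this form after restriction along a cover. *)
Definition elt_map X (W : D) (x : element X W) : @hom E (yo W) X :=
  @induced (yo W) X x (fun V a b ab =>
    match ab in _ = c return eqrel X (x ∘ a) (x ∘ c) with
      eq_refl => eqrel_refl _ end).

Lemma elt_map_eqP X (W : D) (x y : element X W) :
  elt_map x = elt_map y <-> eqrel X x y.
Proof.
split=> [xy|xy].
  have : graph (elt_map y) (idm W) y by rewrite /= comp_idr; apply: eqrel_refl.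
  by rewrite -xy /= comp_idr.
apply: graph_le_eq => V a b /=; apply: eqrel_trans.
by apply: eqrel_stable; apply: eqrel_sym.
Qed.

(** Evaluation at the generic element [idm W] turns the equation into a statement about graphs. This
    is the bridge between diagrams and elements used from here on. *)
Lemma comp_elt_map X Y (F : hom X Y) (W : D) (x : element X W)
    (y : element Y W) : F ∘ elt_map x = elt_map y <-> graph F x y.
Proof.
split=> [Fx|Fxy].
  have : graph (elt_map y) (idm W) y by rewrite /= comp_idr; apply: eqrel_refl.
  rewrite -Fx => -[W' [e [b [ce [/= xb Fb]]]]].
  apply: (graph_local ce); apply: graph_congl Fb.
  by apply: eqrel_sym; rewrite comp_idl in xb.
apply: graph_comp_local => V a b c /= xb Fbc.
by apply: (graph_single _ Fbc); apply: (graph_congl xb); apply: graph_stable.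
Qed.

Lemma elt_map_yo X (W W' : D) (x : element X W) (f : hom W' W) :
  elt_map x ∘ yo_map f = elt_map (x ∘ f).
Proof.
by apply: graph_comp_local => V a b c /= <-; rewrite compA.
Qed.

Lemma elt_map_yoE (W V : D) (x : hom W V) : @elt_map (yo V) W x = yo_map x.
Proof. by apply: graph_le_eq. Qed.

Lemma yo_local_element X (W : D) (F : hom (yo W) X) :
  exists (W' : D) (e : hom W' W) (x : element X W'),
    cover e /\ graph F e x.
Proof.
by have [W' [e [x]]] := graph_total F (idm W); rewrite comp_idl; exists W', e, x.
Qed.

(** * Covers in the completion are the surjective maps *)

Definition surjective X Y (F : hom X Y) : Prop :=
  forall (W : D) (y : element Y W),
  exists (W' : D) (e : hom W' W) (x : element X W'),
    cover e /\ graph F x (y ∘ e).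

(** The map [k] coequalizes whatever pair [F] is a coequalizer of, because [m] is mono; so [k]
    descends along [F] to a section of [m]. *)
Lemma mono_surjective_cover X Y I (F : hom X Y) (k : hom X I) (m : hom I Y) :
  mono m -> m ∘ k = F -> cover F -> surjective m.
Proof.
move=> mm mk [V [u [v [uv uF]]]].
have [h [hF _]] : exists! h, h ∘ F = k.
  by apply: uF; apply: mm; rewrite !compA mk.
have mh : m ∘ h = idm Y.
  apply: (cover_epi (e := F)); first by exists V, u, v.
  by rewrite -compA hF mk comp_idl.
move=> W y; have : graph (idm Y) y y by apply: eqrel_refl.
by rewrite -mh => -[W' [e [x [ce [_ mx]]]]]; exists W', e, x.
Qed.

(** The map is factored through its image, whose inclusion [m] is surjective by the previous lemma,
    while elements of the image lift locally to [X] by construction. *)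
Lemma cover_surjective X Y (F : hom X Y) : cover F -> surjective F.
Proof.
move=> cF.
have [P [G [p1 [p2 [t [pr [mt tF]]]]]]] := graph_subobject F.
have [I [k [i [ck [mi ik]]]]] := has_images regD (p2 ∘ t).
have imF (W : D) (a : element X W) (b : element Y W) :
    graph F a b -> exists c : hom W I, i ∘ c = b.
  by move=> /tF [h [_ <-]]; exists (k ∘ h); rewrite !compA ik.
have Fim (W : D) (c : hom W I) : exists (W' : D) (e : hom W' W)
    (a : element X W'), cover e /\ graph F a (i ∘ c ∘ e).
  have [W' [e [w [ce kw]]]] := cover_lift regD c ck.
  exists W', e, (p1 ∘ (t ∘ w)); split=> //; apply/tF; exists w; split=> //.
  by rewrite compA -ik -!compA kw.
(* The image object: all representatives in [Y] of values of [F], with the equivalence relation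
   restricted from [Y]. *)
pose J : E := @BoundedEqrel D I (fun W a b => eqrel Y (i ∘ a) (i ∘ b))
  (bounded_preimage i i (eqrel_bounded Y))
  (fun W a => eqrel_refl _) (fun W a b => @eqrel_sym _ _ _ _ _)
  (fun W a b c => @eqrel_trans _ _ _ _ _ _).
pose m : hom J Y := @induced J Y i (fun W a b ab => ab).
have mm : mono m.
  move=> Z u v uv; apply: graph_le_eq => W a b uab.
  have : graph (m ∘ u) a (i ∘ b).
    by apply: graph_comp uab _; apply: eqrel_refl.
  rewrite uv => -[W' [e [c [ce [vac /= cb]]]]].
  apply: (graph_local ce); apply: graph_congr vac.
  by rewrite /= compA.
have sF : is_subobject (fun W (a : element X W) (c : hom W I) =>
    graph F a (i ∘ c)).
  have := subobject_preimage (idm _) i (graph_subobject F).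
  rewrite (_ : (fun _ _ _ => _) = (fun W a b => graph F a (i ∘ b))) //.
  by apply: relation_ext => W a b; rewrite comp_idl.
have cmp W (a a' : element X W) (c c' : hom W I) : eqrel X a a' ->
    eqrel J c c' -> graph F a (i ∘ c) -> graph F a' (i ∘ c').
  by move=> aa' cc'; exact: (@graph_compat _ _ _ F _ _ _ _ _ aa' cc').
have tot W (a : element X W) : exists (W' : D) (e : hom W' W) (c : hom W' I),
    cover e /\ graph F (a ∘ e) (i ∘ c).
  have [W' [e [b [ce Fab]]]] := graph_total F a.
  by have [c ic] := imF _ _ _ Fab; exists W', e, c; rewrite ic.
pose q : hom X J := @FunctionalRelation D X J _ sF cmp
  (fun W a c c' => @graph_single _ _ _ F W a (i ∘ c) (i ∘ c')) tot.
have mq : m ∘ q = F.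
  by apply: graph_comp_local => W a c b /= Fac cb; apply: graph_congr Fac.
move=> W y.
have [W1 [e1 [c [ce1 /= cy]]]] := mono_surjective_cover mm mq cF y.
have [W2 [e2 [a [ce2 Fac]]]] := Fim _ c.
exists W2, (e1 ∘ e2), a; split; first exact: cover_comp.
by apply: graph_congr Fac; rewrite compA; apply: eqrel_stable.
Qed.

(** [F] is the coequalizer of its kernel pair: a map [k] equalizing it factors as the relational
    composite of [k] with the converse of [F], which is total because [F] is surjective. *)
Lemma surjective_cover X Y (F : hom X Y) : surjective F -> cover F.
Proof.
move=> sF.
have sC := subobject_converse (graph_subobject F).
(* [G] consists of the pairs of representatives with a common value under [F]; [yo G] then serves as
   the source of the parallel pair. *)
have [P [G [p1 [p2 [t [pr [mt tK]]]]]]] :=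
  subobject_comp regD sC (graph_subobject F).
pose u : element X G := p1 ∘ t; pose v : element X G := p2 ∘ t.
have kerE (W : D) (a a' : element X W) (b : element Y W) :
    graph F a b -> graph F a' b -> exists h : hom W G, u ∘ h = a /\ v ∘ h = a'.
  move=> Fab Fab'; have [|h [<- <-]] := proj1 (tK W a a').
    by exists W, (idm W), b; rewrite !comp_idr; split; first exact: cover_id.
  by exists h; rewrite /u /v !compA.
exists (yo G), (elt_map u), (elt_map v); split.
  have [W [e [b [ce [Fu Fv]]]]] : rel_comp (fun W a b => graph F b a)
      (@graph _ _ _ F) u v.
    by apply/tK; exists (idm G); rewrite !comp_idr.
  apply: graph_comp_local => V a x y /= ux Fxy.
  have [V' [e' [w [ce' ew]]]] := cover_lift regD a ce.
  have xw : eqrel X (x ∘ e') (u ∘ e ∘ w).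
    by rewrite -compA ew compA; apply: eqrel_stable; apply: eqrel_sym.
  exists V', e', (v ∘ (a ∘ e')); split=> //; split; first exact: eqrel_refl.
  have Fy : graph F (u ∘ e ∘ w) (y ∘ e').
    by apply: graph_congl xw _; apply: graph_stable.
  have by' := graph_single (graph_stable w Fu) Fy.
  by apply: (graph_congr by'); rewrite -ew compA; apply: graph_stable.
move=> Z k kuv.
(* [k] is constant on the fibres of [F], which makes the factorization single-valued. *)
have kE (W : D) (a a' : element X W) (b : element Y W) (z : element Z W) :
    graph F a b -> graph F a' b -> graph k a z -> graph k a' z.
  move=> Fab Fab' kz; have [h [ua va]] := kerE _ _ _ _ Fab Fab'.
  have ka : graph k (u ∘ h) z -> graph k (v ∘ h) z.
    move=> /comp_elt_map; rewrite -elt_map_yo compA kuv -compA elt_map_yo.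
    by move=> /comp_elt_map.
  by move: ka; rewrite ua va; apply.
have hc W (b b' : element Y W) (z z' : element Z W) : eqrel Y b b' ->
    eqrel Z z z' -> rel_comp (@graph _ _ _ k) (fun W b a => graph F a b) b z ->
    rel_comp (@graph _ _ _ k) (fun W b a => graph F a b) b' z'.
  move=> bb' zz' [W' [e [a [ce [Fab kaz]]]]]; exists W', e, a; split=> //.
  split; first by apply: graph_congr Fab; apply: eqrel_stable.
  by apply: graph_congr kaz; apply: eqrel_stable.
have hs W (b : element Y W) (z z' : element Z W) :
    rel_comp (@graph _ _ _ k) (fun W b a => graph F a b) b z ->
    rel_comp (@graph _ _ _ k) (fun W b a => graph F a b) b z' -> eqrel Z z z'.
  move=> [W1 [e1 [a1 [ce1 [F1 k1]]]]] [W2 [e2 [a2 [ce2 [F2 k2]]]]].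
  have [V [v1 [v2 [cv1 ev]]]] := cover_lift regD e1 ce2.
  apply: (subobject_local (bounded_subobject (eqrel_bounded Z))
            (cover_comp regD ce1 cv1)).
  have {}F1 := graph_stable v1 F1; have {}k1 := graph_stable v1 k1.
  have {}F2 := graph_stable v2 F2; have {}k2 := graph_stable v2 k2.
  move: F2 k2; rewrite -!compA ev => F2 k2; rewrite -!compA in F1 k1.
  exact: (graph_single (kE _ _ _ _ _ F1 F2 k1) k2).
have ht W (b : element Y W) : exists (W' : D) (e : hom W' W) (z : element Z W'),
    cover e /\ rel_comp (@graph _ _ _ k) (fun W b a => graph F a b) (b ∘ e) z.
  have [W1 [e1 [a [ce1 Fab]]]] := sF _ b.
  have [W2 [e2 [z [ce2 kaz]]]] := graph_total k a.
  exists W2, (e1 ∘ e2), z; split; first exact: cover_comp.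
  exists W2, (idm W2), (a ∘ e2); rewrite !comp_idr compA.
  split; first exact: cover_id.
  by split=> //; apply: graph_stable.
pose h : hom Y Z := @FunctionalRelation D Y Z _
  (subobject_comp regD (graph_subobject k) sC) hc hs ht.
exists h; split.
  apply: graph_comp_local => W a b z Fab [W' [e [a' [ce [Fa'b ka'z]]]]].
  apply: (graph_local ce); apply: (kE _ _ _ _ _ Fa'b _ ka'z).
  exact: graph_stable.
move=> h' h'F; apply: graph_le_eq => W b z [W' [e [a [ce [Fab kaz]]]]].
apply: (graph_local ce); move: kaz.
rewrite -h'F => -[W2 [e2 [b' [ce2 [Fab' h'b'z]]]]].
apply: (graph_local ce2); apply: graph_congl h'b'z.
by apply: (graph_single Fab'); apply: graph_stable.
Qed.

(** * Pullbacks and quasi-pullbacks in terms of elements *)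

Definition elementwise_pullback X Y Z P (p1 : hom P X) (p2 : hom P Y)
    (f : hom X Z) (g : hom Y Z) : Prop :=
  f ∘ p1 = g ∘ p2 /\
  (forall (W : D) (x : element X W) (y : element Y W) (z : element Z W),
    graph f x z -> graph g y z ->
    exists (W' : D) (e : hom W' W) (p : element P W'),
      cover e /\ graph p1 p (x ∘ e) /\ graph p2 p (y ∘ e)) /\
  (forall (W : D) (p p' : element P W) (x : element X W) (y : element Y W),
    graph p1 p x -> graph p2 p y -> graph p1 p' x -> graph p2 p' y ->
    eqrel P p p').

(** The universal property is tested on objects [yo W]; the mediating map has a representative only
    on a cover, which accounts for the refinement in the lifting clause. *)
Lemma pullback_elementwise X Y Z P (p1 : hom P X) (p2 : hom P Y)
    (f : hom X Z) (g : hom Y Z) :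
  is_pullback p1 p2 f g -> elementwise_pullback p1 p2 f g.
Proof.
move=> [fg pb]; split=> //; split.
- move=> W x y z /comp_elt_map fx /comp_elt_map gy.
  have [h [[h1 h2] _]] := pb _ (elt_map x) (elt_map y) (eq_trans fx (eq_sym gy)).
  have [W' [e [p [ce hp]]]] := yo_local_element h.
  exists W', e, p; split=> //; split; apply/comp_elt_map;
    rewrite -(proj2 (comp_elt_map h e p) hp) compA ?h1 ?h2 elt_map_yoE;
    exact: elt_map_yo.
- move=> W p p' x y /comp_elt_map p1x /comp_elt_map p2y.
  move=> /comp_elt_map p1'x /comp_elt_map p2'y.
  have [|h [_ hu]] := pb _ (elt_map x) (elt_map y).
    by rewrite -p1x -p2y !compA fg.
  by apply/elt_map_eqP; rewrite -(hu (elt_map p)) // (hu (elt_map p')).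
Qed.

(** The mediating map relates [v] to those [p] whose two components are the values of [a] and [b] at
    [v]. The lifting clause gives totality and the injectivity clause single-valuedness. *)
Lemma elementwise_is_pullback X Y Z P (p1 : hom P X) (p2 : hom P Y)
    (f : hom X Z) (g : hom Y Z) :
  elementwise_pullback p1 p2 f g -> is_pullback p1 p2 f g.
Proof.
move=> [fg [lift inj]]; split=> // V a b ab.
have part Q (q : hom P Q) (c : hom V Q) := subobject_comp regD
  (subobject_converse (graph_subobject q)) (graph_subobject c).
(* [R] relates [v] to [p] when [q] at [p] and [c] at [v] have a common value; it is used for each of
   the two projections. *)
pose R Q (q : hom P Q) (c : hom V Q) : relation_family (carrier V) (carrier P)
  := rel_comp (fun W y p => graph q p y) (@graph _ _ _ c).
have Rcompat Q (q : hom P Q) (c : hom V Q) W (v v' : element V W)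
    (p p' : element P W) :
    eqrel V v v' -> eqrel P p p' -> R Q q c W v p -> R Q q c W v' p'.
  move=> vv' pp' [W' [e [x [ce [cvx qpx]]]]]; exists W', e, x; split=> //.
  split; first by apply: graph_congl cvx; apply: eqrel_stable.
  by apply: graph_congl qpx; apply: eqrel_stable.
have Rval Q (q : hom P Q) (c : hom V Q) W (v : element V W) (p : element P W)
    (x : element Q W) : R Q q c W v p -> graph c v x -> graph q p x.
  move=> [W' [e [x' [ce [cvx' qpx']]]]] cvx; apply: (graph_local ce).
  by apply: graph_congr qpx'; apply: (graph_single cvx'); apply: graph_stable.
have Rintro Q (q : hom P Q) (c : hom V Q) W (v : element V W) (p : element P W)
    (x : element Q W) : graph c v x -> graph q p x -> R Q q c W v p.
  move=> cvx qpx; exists W, (idm W), x; rewrite !comp_idr.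
  by split; first exact: cover_id.
have vals W (v : element V W) : exists (W' : D) (e : hom W' W)
    (x : element X W') (y : element Y W'),
    cover e /\ graph a (v ∘ e) x /\ graph b (v ∘ e) y.
  have [W1 [e1 [x [ce1 ax]]]] := graph_total a v.
  have [W2 [e2 [y [ce2 bY]]]] := graph_total b (v ∘ e1).
  exists W2, (e1 ∘ e2), (x ∘ e2), y; split; first exact: cover_comp.
  by rewrite compA; split=> //; apply: graph_stable.
have hc W (v v' : element V W) (p p' : element P W) : eqrel V v v' ->
    eqrel P p p' -> R X p1 a W v p /\ R Y p2 b W v p ->
    R X p1 a W v' p' /\ R Y p2 b W v' p'.
  by move=> vv' pp' [? ?]; split; apply: (Rcompat _ _ _ _ _ _ _ _ vv' pp').
have Rstable Q (q : hom P Q) (c : hom V Q) W W' (e : hom W' W)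
  (v : element V W) (p : element P W) :
  R Q q c W v p -> R Q q c W' (v ∘ e) (p ∘ e).
  exact: subobject_stable (part Q q c).
have hs W (v : element V W) (p p' : element P W) :
    R X p1 a W v p /\ R Y p2 b W v p -> R X p1 a W v p' /\ R Y p2 b W v p' ->
    eqrel P p p'.
  move=> [r1 r2] [r1' r2']; have [W' [e [x [y [ce [ax bY]]]]]] := vals _ v.
  apply: (subobject_local (bounded_subobject (eqrel_bounded P)) ce).
  by apply: (inj _ _ _ x y); [apply: Rval ax | apply: Rval bY | apply: Rval ax
    | apply: Rval bY]; apply: Rstable.
have ht W (v : element V W) : exists (W' : D) (e : hom W' W) (p : element P W'),
    cover e /\ R X p1 a W' (v ∘ e) p /\ R Y p2 b W' (v ∘ e) p.
  have [W1 [e1 [x [y [ce1 [ax bY]]]]]] := vals _ v.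
  have [W2 [e2 [z [ce2 fx]]]] := graph_total f x.
  have : graph (g ∘ b) (v ∘ e1 ∘ e2) z.
    by rewrite -ab; apply: graph_comp fx; apply: graph_stable.
  move=> [W3 [e3 [y' [ce3 [bY' gy']]]]].
  have [W4 [e4 [p [ce4 [p1x p2y]]]]] :=
    lift _ _ _ _ (graph_stable e3 fx) gy'.
  have ce := cover_comp regD (cover_comp regD ce1 ce2) (cover_comp regD ce3 ce4).
  exists W4, (e1 ∘ e2 ∘ (e3 ∘ e4)), p; split=> //; split.
    apply: (Rintro _ _ _ _ _ _ _ _ p1x); rewrite !compA.
    by do 3!apply: graph_stable.
  apply: (Rintro _ _ _ _ _ _ _ _ p2y); rewrite !compA.
  exact: (graph_stable e4 bY').
pose h : hom V P := @FunctionalRelation D V P _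
  (subobject_meet (part X p1 a) (part Y p2 b)) hc hs ht.
have val1 : p1 ∘ h = a.
  apply: graph_comp_local => W v p x [r1 _] p1x.
  have [W' [e [x' [ce ax']]]] := graph_total a v.
  have p1x' := Rval _ _ _ _ _ _ _ (Rstable _ _ _ _ _ e _ _ r1) ax'.
  apply: (graph_local ce); apply: graph_congr ax'.
  by apply: (graph_single p1x'); apply: graph_stable.
have val2 : p2 ∘ h = b.
  apply: graph_comp_local => W v p y [_ r2] p2y.
  have [W' [e [y' [ce bY']]]] := graph_total b v.
  have p2y' := Rval _ _ _ _ _ _ _ (Rstable _ _ _ _ _ e _ _ r2) bY'.
  apply: (graph_local ce); apply: graph_congr bY'.
  by apply: (graph_single p2y'); apply: graph_stable.
exists h; split=> // h' [h'1 h'2]; apply/eq_sym/graph_le_eq => W v p h'vp; split.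
- have [W' [e [x [ce p1x]]]] := graph_total p1 p.
  exists W', e, x; split=> //; split=> //; rewrite -h'1.
  by apply: graph_comp p1x; apply: graph_stable.
- have [W' [e [x [ce p1x]]]] := graph_total p2 p.
  exists W', e, x; split=> //; split=> //; rewrite -h'2.
  by apply: graph_comp p1x; apply: graph_stable.
Qed.

(** The carrier [G] consists of pairs of representatives with a common value in [Z], identified
    componentwise; this relation is bounded as a meet of preimages of bounded ones. *)
Lemma completion_pullbacks X Y Z (f : hom X Z) (g : hom Y Z) :
  exists P (p1 : hom P X) (p2 : hom P Y), is_pullback p1 p2 f g.
Proof.
have [Q [G [q1 [q2 [m [pr [mm tG]]]]]]] := subobject_comp regD
  (subobject_converse (graph_subobject g)) (graph_subobject f).
pose x : element X G := q1 ∘ m; pose y : element Y G := q2 ∘ m.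
pose P : E := @BoundedEqrel D G
  (fun W a b => eqrel X (x ∘ a) (x ∘ b) /\ eqrel Y (y ∘ a) (y ∘ b))
  (bounded_meet (bounded_preimage x x (eqrel_bounded X))
     (bounded_preimage y y (eqrel_bounded Y)))
  (fun W a => conj (eqrel_refl _) (eqrel_refl _))
  (fun W a b ab => conj (eqrel_sym (proj1 ab)) (eqrel_sym (proj2 ab)))
  (fun W a b c ab bc => conj (eqrel_trans (proj1 ab) (proj1 bc))
     (eqrel_trans (proj2 ab) (proj2 bc))).
pose p1 : hom P X := @induced P X x (fun W a b ab => proj1 ab).
pose p2 : hom P Y := @induced P Y y (fun W a b ab => proj2 ab).
exists P, p1, p2; apply: elementwise_is_pullback; split; last split.
- apply: graph_comp_local => W p x' z /= xx' fz.
  have [W' [e [z' [ce [fz' gz']]]]] : rel_comp (fun W b a => graph g a b)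
      (@graph _ _ _ f) (x ∘ p) (y ∘ p).
    by apply/tG; exists p; rewrite /x /y !compA.
  exists W', e, (y ∘ p ∘ e); split=> //; split.
    by rewrite /= compA; apply: eqrel_refl.
  apply: graph_congr gz'; apply: (graph_single fz').
  by apply: graph_stable; apply: graph_congl fz; apply: eqrel_sym.
- move=> W a b z fa gb.
  have [|p [<- <-]] := proj1 (tG W a b).
    by exists W, (idm W), z; rewrite !comp_idr; split; first exact: cover_id.
  exists W, (idm W), p; rewrite !comp_idr; split; first exact: cover_id.
  by rewrite /= /x /y -!compA; split; apply: eqrel_refl.
- move=> W p p' a b /= pa pb pa' pb'.
  by split; [apply: eqrel_trans pa _ | apply: eqrel_trans pb _];
    apply: eqrel_sym.
Qed.

Lemma quasi_pullback_elementwise X Y Z P (q : hom P X) (g : hom P Y)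
    (f : hom X Z) (p : hom Y Z) (W : D) (x : element X W) (y : element Y W)
    (z : element Z W) :
  quasi_pullback q g f p -> graph f x z -> graph p y z ->
  exists (W' : D) (e : hom W' W) (w : element P W'),
    cover e /\ graph q w (x ∘ e) /\ graph g w (y ∘ e).
Proof.
move=> [Q [p1 [p2 [u [/pullback_elementwise [_ [lift _]]]]]]].
move=> [<- [<- /cover_surjective su]] fx py.
have [W1 [e1 [w1 [ce1 [x1 y1]]]]] := lift _ _ _ _ fx py.
have [W2 [e2 [w2 [ce2 uw]]]] := su _ w1.
exists W2, (e1 ∘ e2), w2; split; first exact: cover_comp.
by rewrite !compA; split; apply: (graph_comp uw); apply: graph_stable.
Qed.

(** The components of an element [w] of the pullback lift to some [d] in [P]; the value of [u] at
    [d] has the same components as [w], hence is equivalent to it. *)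
Lemma surjective_to_pullback X Y Z P Q (q : hom P X) (g : hom P Y)
    (f : hom X Z) (p : hom Y Z) (p1 : hom Q X) (p2 : hom Q Y) (u : hom P Q) :
  (forall (W : D) (x : element X W) (y : element Y W) (z : element Z W),
    graph f x z -> graph p y z ->
    exists (W' : D) (e : hom W' W) (w : element P W'),
      cover e /\ graph q w (x ∘ e) /\ graph g w (y ∘ e)) ->
  is_pullback p1 p2 f p -> p1 ∘ u = q -> p2 ∘ u = g -> surjective u.
Proof.
move=> lift /pullback_elementwise [fp [_ inj]] u1 u2 W w.
have [W1 [e1 [x [ce1 p1x]]]] := graph_total p1 w.
have [W2 [e2 [z [ce2 fx]]]] := graph_total f x.
have : graph (p ∘ p2) (w ∘ e1 ∘ e2) z.
  by rewrite -fp; apply: graph_comp fx; apply: graph_stable.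
move=> [W3 [e3 [y [ce3 [p2y py]]]]].
have [W4 [e4 [d [ce4 [qd gd]]]]] := lift _ _ _ _ (graph_stable e3 fx) py.
have ce := cover_comp regD (cover_comp regD ce1 ce2) (cover_comp regD ce3 ce4).
have [W5 [e5 [w' [ce5 ud]]]] := graph_total u d.
exists W5, (e1 ∘ e2 ∘ (e3 ∘ e4) ∘ e5), (d ∘ e5); split; first exact: cover_comp.
apply: (graph_congr _ ud).
apply: (inj _ _ _ (x ∘ e2 ∘ e3 ∘ e4 ∘ e5) (y ∘ e4 ∘ e5)).
- apply: (graph_comp_elim ud); rewrite u1.
  exact: (graph_stable e5 qd).
- apply: (graph_comp_elim ud); rewrite u2.
  exact: (graph_stable e5 gd).
- by rewrite !compA; do 4!apply: graph_stable.
- by move: (graph_stable e5 (graph_stable e4 p2y)); rewrite !compA.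
Qed.

Lemma elementwise_quasi_pullback X Y Z P (q : hom P X) (g : hom P Y)
    (f : hom X Z) (p : hom Y Z) :
  f ∘ q = p ∘ g ->
  (forall (W : D) (x : element X W) (y : element Y W) (z : element Z W),
    graph f x z -> graph p y z ->
    exists (W' : D) (e : hom W' W) (w : element P W'),
      cover e /\ graph q w (x ∘ e) /\ graph g w (y ∘ e)) ->
  quasi_pullback q g f p.
Proof.
move=> fq lift; have [Q [p1 [p2 pb]]] := completion_pullbacks f p.
have [u [[u1 u2] _]] := proj2 pb _ _ _ fq.
exists Q, p1, p2, u; split=> //; split=> //; split=> //.
by apply: surjective_cover; apply: (surjective_to_pullback lift pb).
Qed.

(** * Covers, pullbacks and targets in the image of the embedding *)

Lemma elt_map_cover X (W : D) (x : element X W) :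
  (forall (V : D) (y : element X V), exists (V' : D) (e : hom V' V)
    (w : hom V' W), cover e /\ x ∘ w = y ∘ e) -> cover (elt_map x).
Proof.
move=> lift; apply: surjective_cover => V y.
have [V' [e [w [ce xw]]]] := lift _ y; exists V', e, w; split=> //=.
by rewrite xw; apply: eqrel_refl.
Qed.

Lemma yo_map_cover (V W : D) (e : hom V W) : cover e -> cover (yo_map e).
Proof.
move=> ce; rewrite -elt_map_yoE; apply: elt_map_cover => U y.
exact: cover_lift.
Qed.

Lemma yo_pullback (P X Y Z : D) (p1 : hom P X) (p2 : hom P Y) (f : hom X Z)
    (g : hom Y Z) :
  is_pullback p1 p2 f g ->
  is_pullback (yo_map p1) (yo_map p2) (yo_map f) (yo_map g).
Proof.
move=> [fg pb]; apply: elementwise_is_pullback; split; last split.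
- by rewrite -!yo_map_comp fg.
- move=> W x y z /= fx gy.
  have [h [[<- <-] _]] := pb _ x y (eq_trans fx (eq_sym gy)).
  exists W, (idm W), h; rewrite !comp_idr; split=> //; exact: cover_id.
- move=> W u v x y /= <- <- u1 u2.
  have [h [_ hu]] := pb _ (p1 ∘ u) (p2 ∘ u) ltac:(by rewrite !compA fg).
  by rewrite -(hu u) // (hu v).
Qed.

(** Composing [r] with the quotient map from [yo (carrier X)] gives a map between embedded objects,
    which comes from [D] by fullness. Values of [r] thus exist without refinement. *)
Lemma yo_target_element (A : D) X (r : hom X (yo A)) :
  exists r' : hom (carrier X) A,
    forall (W : D) (x : element X W), graph r x (r' ∘ x).
Proof.
have [r' r'E] := yo_map_full (r ∘ elt_map (idm (carrier X))).
exists r' => W x; apply/comp_elt_map.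
rewrite elt_map_yoE yo_map_comp r'E -compA; congr (r ∘ _).
by rewrite elt_map_yo comp_idl.
Qed.

(** * Smallness of maps over an embedded object *)

Lemma small_over (P A : D) (g : hom P A) (B : E) (k : hom (yo P) B)
    (r : hom B (yo A)) : display g -> r ∘ k = yo_map g -> small k.
Proof.
move=> dg rk; have [r' rE] := yo_target_element r.
have [G [e [b [ce kb]]]] := yo_local_element k.
(* [M] consists of the pairs of a representative in [B] and a point of [P] lying over the same point
   of [A]; it is display over the carrier of [B]. *)
have [M [m1 [m2 pbM]]] := has_pullbacks regD r' g.
have dm1 := dm_pullback (display_axioms D) pbM dg.
(* The cover [W] of [M] carries a representative [b ∘ w] of the value of [k]. Collection replaces it
   by [Z], display over a cover [B'] of the carrier of [B]. *)
have [W [c [w [cc ew]]]] := cover_lift regD m2 ce.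
have [Z [B' [z [h [l [dh [cl qp]]]]]]] :=
  dm_collection (display_axioms D) cc dm1.
have [P' [G' [p1 [p2 [n [tn dn]]]]]] := eqrel_bounded B.
(* [Z'] is the part of [Z] where the value of [k] is equivalent to the base point in [B];
   boundedness of the equivalence relation makes [j] display. *)
have [Z' [j [mj [dj jE]]]] := tabulates_comprehension (b ∘ w ∘ z) (l ∘ h) tn.
have kZ (V : D) (v : hom V Z) : graph k (m2 ∘ (c ∘ z) ∘ v) (b ∘ w ∘ z ∘ v).
  have := graph_stable (w ∘ z ∘ v) kb.
  by rewrite (compA e) (compA e) ew !compA.
exists Z', B', (h ∘ j), (yo_map (m2 ∘ (c ∘ z) ∘ j)), (elt_map l); split.
  exact: dm_comp (display_axioms D) _ _ _ _ _ dh (dj dn).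
split; first by apply: elt_map_cover => V y; apply: cover_lift.
apply: elementwise_quasi_pullback.
  rewrite elt_map_yo -elt_map_yoE; apply/comp_elt_map.
  apply: graph_congr (kZ _ j); rewrite compA; apply/jE.
  by exists (idm Z'); rewrite comp_idr.
move=> V x y a kx /= ya.
have rx : g ∘ x = r' ∘ a.
  have := graph_comp kx (rE _ a); rewrite rk; exact.
(* As [r] takes values in [yo A], equivalent representatives have equal images under [r']; so
   [l ∘ y] and [x] form an element of [M], which lifts to [Z] and then lies in [Z']. *)
have ry : r' ∘ (l ∘ y) = g ∘ x.
  by rewrite rx; apply: (graph_single (graph_congl ya (rE _ _)) (rE _ a)).
have [mu [[mu1 mu2] _]] := proj2 pbM _ _ _ ry.
have [V' [e' [v [ce' [v1 v2]]]]] := quasi_pullback_lift qp mu1.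
have [j' jj'] : exists j', j ∘ j' = v.
  apply/jE; rewrite -(compA l) v2 compA.
  apply: eqrel_trans (eqrel_sym (eqrel_stable e' ya)).
  apply: (graph_single (kZ _ v)); rewrite -(compA m2) v1 compA mu2.
  exact: graph_stable.
exists V', e', j'; split=> //=; rewrite -!(compA _ j) jj'.
by rewrite -(compA m2) v1 compA mu2.
Qed.

End Elements.

(** * Transfer of multiple choice to the completion *)

Theorem theorem3p6 (D : display_category) :
  AMC (@display D) -> AMC (@small D).
Proof.
have regD := ph_regular (dcat_positive_heyting D).
move=> amc Y X F [B' [A' [f' [q [p [df' [cp qp]]]]]]].
have [A0 [q0 [cq0 [B0 [f0 [r0 [[fr0 pb0] [D0 [C0 [s0 [g0 [p0 [col]]]]]]]]]]]]] :=
  amc _ _ f' df'.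
move: col => [[cp0 qp0] col] [ds0 [dg0 [df0 dp0]]].
have [B [f1 [r pb]]] := completion_pullbacks (p ∘ yo_map q0) F.
have Fq : F ∘ q = p ∘ yo_map f'.
  by have [Q [t1 [t2 [v [[E _] [<- [<- _]]]]]]] := qp; rewrite !compA E.
(* The comparison of the embedded pullback [B0] with the pullback [B] of [F] in the completion. *)
have [u [[u1 u2] _]] : exists! u : hom (yo B0) B,
    f1 ∘ u = yo_map f0 /\ r ∘ u = q ∘ yo_map r0.
  by apply: (proj2 pb); rewrite compA Fq -!compA -!yo_map_comp fr0.
(* An element of [B] has components [a] and [y]; the covering square lifts [y] and [q0 ∘ a] to some
   [b'] in [B'], and [a] with [b'] is an element of [B0]. *)
have su : surjective u.
  apply: (surjective_to_pullback _ pb u1 u2) => W a y x pa Fy.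
  have q0a : graph (yo_map q0) a (q0 ∘ a) by [].
  have [W' [e [b' [ce [qb' /= fb']]]]] :=
    quasi_pullback_elementwise qp Fy (graph_comp_elim q0a pa).
  have [b [[fb rb] _]] := pb0 _ (a ∘ e) b' ltac:(by rewrite compA fb').
  exists W', e, b; split=> //; split=> //.
  exact: (graph_comp (rb : graph (yo_map r0) b b') qb').
have f0s0 : f0 ∘ s0 = p0 ∘ g0.
  by have [Q [t1 [t2 [v [[E _] [<- [<- _]]]]]]] := qp0; rewrite !compA E.
exists (yo A0), (p ∘ yo_map q0); split.
  apply: surjective_cover => W x.
  have [W1 [e1 [a' [ce1 pa']]]] := cover_surjective cp x.
  have [W2 [e2 [a [ce2 q0a]]]] := cover_lift regD a' cq0.
  exists W2, (e1 ∘ e2), a; split; first exact: cover_comp.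
  rewrite compA; apply: (@graph_comp _ _ _ _ p (yo_map q0) _ a (a' ∘ e2)) => //.
  exact: graph_stable.
exists B, f1, r; split=> //.
exists (yo D0), (yo C0), (u ∘ yo_map s0), (yo_map g0), (yo_map p0).
have f1s : f1 ∘ (u ∘ yo_map s0) = yo_map (f0 ∘ s0).
  by rewrite compA u1 yo_map_comp.
split; last split; last split; last split.
- split; first split; first exact: yo_map_cover.
    apply: elementwise_quasi_pullback; first by rewrite f1s f0s0 yo_map_comp.
    move=> W b c a f1b /= p0c.
    have [W1 [e1 [b0 [ce1 ub0]]]] := su _ b.
    have fb0 : f0 ∘ b0 = p0 ∘ (c ∘ e1).
      have := graph_comp ub0 (graph_stable e1 f1b); rewrite u1 /= => ->.
      by rewrite compA p0c.
    have [W2 [e2 [d [ce2 [sd gd]]]]] := quasi_pullback_lift qp0 fb0.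
    exists W2, (e1 ∘ e2), d; split; first exact: cover_comp.
    rewrite !compA; split=> //.
    by apply: (graph_comp (sd : graph (yo_map s0) d _)); apply: graph_stable.
  move=> T a Ba b1 b2 /pullback_elementwise [ab [lift _]].
  move=> V e /cover_surjective se.
  have [a1 aE] := yo_target_element a.
  (* [N] is the fibre of [f0] over [a1]. Its elements are sent by [u] to [B], then lifted to [Ba]
     and along [e] to [V], each time after a cover; the resulting [W3] is a cover of [N] in [D]. *)
  have [N [n1 [n2 pbN]]] := has_pullbacks regD a1 f0.
  have [W1 [e1 [b [ce1 ub]]]] := graph_total u n2.
  have f1b : graph f1 b (a1 ∘ (n1 ∘ e1)).
    by apply: (graph_comp_elim ub); rewrite u1 /= !compA (proj1 pbN).
  have [W2 [e2 [x [ce2 [b1x b2x]]]]] := lift _ _ _ _ (aE _ (n1 ∘ e1)) f1b.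
  have [W3 [e3 [y [ce3 ey]]]] := se _ x.
  have ce := cover_comp regD (cover_comp regD ce1 ce2) ce3.
  have [T' [t [c [ct [pc [Dc [d1 [d2 [h [pbD [h1 h2]]]]]]]]]]] :=
    col _ _ _ _ _ pbN _ _ ce.
  exists (yo T'), (elt_map t), (yo_map c); split.
    by apply: elt_map_cover => U z; apply: cover_lift.
  split.
    rewrite -yo_map_comp pc -elt_map_yoE; apply/eq_sym/comp_elt_map; exact: aE.
  (* The collection square in [D] gives [h] from [Dc] to [W3]; composing it with the lift [y] yields
     the required map into [V]. *)
  exists (yo Dc), (yo_map d1), (yo_map d2), (elt_map (y ∘ h)).
  split; first exact: yo_pullback.
  have -> : e ∘ elt_map (y ∘ h) = elt_map (x ∘ e3 ∘ h).
    by apply/comp_elt_map; apply: graph_stable.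
  split.
    rewrite elt_map_yo -h1; apply/comp_elt_map.
    by rewrite !compA; do 2!apply: graph_stable.
  rewrite -(compA u) -yo_map_comp -h2 -elt_map_yoE.
  have /comp_elt_map -> : graph u (n2 ∘ (e1 ∘ e2 ∘ e3 ∘ h)) (b ∘ e2 ∘ e3 ∘ h).
    by rewrite !compA; do 3!apply: graph_stable.
  by apply/comp_elt_map; do 2!apply: graph_stable.
(* The top map lies over [yo A0] through [f1], with composite the image of the display map
   [f0 ∘ s0]. *)
- by apply: (small_over _ f1s); apply: (dm_comp (display_axioms D)).
- by apply: (small_over dg0); apply: comp_idl.
(* Surjectivity of [u] says exactly that [f0] covers [f1] over the identity of [yo A0]. *)
- exists B0, A0, f0, u, (idm (yo A0)); split=> //; split; first exact: cover_id.
  apply: elementwise_quasi_pullback; first by rewrite comp_idl.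
  move=> W b a a' f1b /= ->; have [W1 [e1 [b0 [ce1 ub0]]]] := su _ b.
  exists W1, e1, b0; split=> //; split=> //.
  by have := graph_comp ub0 (graph_stable e1 f1b); rewrite u1.
- by apply: (small_over dp0); apply: comp_idl.
Qed.
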